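(* Let $\Lambda=\{\Lambda_\omega\in B(\mathcal{H},\mathcal{K}_\omega):\omega\in\Omega\}$ and $\Theta=\{\Theta_\omega\in B(\mathcal{H},\mathcal{K}_\omega):\omega\in\Omega\}$ be continuous $g$-Bessel families with continuous $g$-Bessel constants $B_\Lambda$ and $B_\Theta$ respectively, and let $0\neq m\in L^\infty(\Omega,\mu)$. If $M_{m,\Lambda,\Theta}\in GL(\mathcal{H})$, then: (i) $m\Theta=\{m(\omega)\Theta_\omega\in B(\mathcal{H},\mathcal{K}_\omega):\omega\in\Omega\}$ and $\overline{m}\Lambda=\{\overline{m(\omega)}\Lambda_\omega\in B(\mathcal{H},\mathcal{K}_\omega):\omega\in\Omega\}$ are continuous $g$-frames with lower continuous $g$-frame bounds $(B_\Lambda\|M_{m,\Lambda,\Theta}^{-1}\|^2)^{-1}$ and $(B_\Theta\|M_{m,\Lambda,\Theta}^{-1}\|^2)^{-1}$, respectively. (ii) $\Theta$ and $\Lambda$ are continuous $g$-frames with lower continuous $g$-frame bounds $(B_\Lambda\|m\|_\infty^2\|M_{m,\Lambda,\Theta}^{-1}\|^2)^{-1}$ and $(B_\Theta\|m\|_\infty^2\|M_{m,\Lambda,\Theta}^{-1}\|^2)^{-1}$, respectively.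
   Context: $(\Omega,\mu)$ is a measure space with positive measure $\mu$, $\mathcal{H}$ is a Hilbert space, $\{\mathcal{K}_\omega:\omega\in\Omega\}$ is a family of Hilbert spaces, $B(\mathcal{H},\mathcal{K}_\omega)$ is the space of bounded linear operators, and $GL(\mathcal{H})$ is the set of all invertible bounded linear operators on $\mathcal{H}$. An element $F\in\prod_{\omega\in\Omega}\mathcal{K}_\omega$ is strongly measurable if $F$, as a mapping of $\Omega$ to $\bigoplus_{\omega\in\Omega}\mathcal{K}_\omega$, is measurable. A family $\Lambda=\{\Lambda_\omega\in B(\mathcal{H},\mathcal{K}_\omega):\omega\in\Omega\}$ is a continuous $g$-frame for $\mathcal{H}$ with respect to $\{\mathcal{K}_\omega\}$ if (a) for each $f\in\mathcal{H}$, $\{\Lambda_\omega f:\omega\in\Omega\}$ is strongly measurable, and (b) there are constants $0<A_\Lambda\le B_\Lambda<\infty$ (lower and upper continuous $g$-frame bounds) with $A_\Lambda\|f\|^2\le\int_\Omega\|\Lambda_\omega f\|^2\,d\mu(\omega)\le B_\Lambda\|f\|^2$ for all $f\in\mathcal{H}$. It is a continuous $g$-Bessel family, with continuous $g$-Bessel constant $B_\Lambda$, if (a) holds and the right-hand inequality in (b) holds for all $f\in\mathcal{H}$. For continuous $g$-Bessel families $\Lambda,\Theta$ and $m\in L^\infty(\Omega,\mu)$, the continuous $g$-Bessel multiplier $M_{m,\Lambda,\Theta}:\mathcal{H}\to\mathcal{H}$ is the bounded operator defined by $\langle M_{m,\Lambda,\Theta}f,g\rangle=\int_\Omega m(\omega)\langle\Theta_\omega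 f,\Lambda_\omega g\rangle\,d\mu(\omega)$ for $f,g\in\mathcal{H}$. *)

(* Defs.v *)
From HB Require Import structures.
From mathcomp Require Import all_boot all_order all_algebra.
From mathcomp Require Import complex.
From mathcomp Require Import all_classical all_reals all_analysis.

Set Implicit Arguments.
Unset Strict Implicit.
Unset Printing Implicit Defensive.

Import Order.TTheory GRing.Theory Num.Theory.
Import numFieldNormedType.Exports.

Local Open Scope classical_set_scope.
Local Open Scope ring_scope.

(* In [{dot V for _}] the form is linear in its first
   argument and conjugate-linear in the second one. *)
HB.mixin Record isHilbert (R : realType) V of CompleteNormedModule R[i] V := {
  inner : {dot V for (@Num.conj R[i])} ;
  norm_inner : forall x : V, `|x| ^+ 2 = inner x x
}.

#[short(type="hilbertType")]
HB.structure Definition Hilbert (R : realType) :=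
  {V of CompleteNormedModule R[i] V & isHilbert R V}.

(* On a normed module over [R[i]] the library norm takes its values in [R[i]];
   [hnorm] is the same norm as an element of [R]. *)
Definition hnorm (R : realType) (V : normedModType R[i]) (x : V) : R :=
  complex.Re `|x|.

Lemma hnormE (R : realType) (V : normedModType R[i]) (x : V) :
  (hnorm x)%:C%C = `|x|.
Proof.
rewrite /hnorm; have := normr_ge0 x.
by case: `|x| => a b; rewrite lecE /= => /andP[/eqP -> _].
Qed.

Lemma hnorm0 (R : realType) (V : normedModType R[i]) : hnorm (0 : V) = 0.
Proof. by rewrite /hnorm normr0. Qed.

Lemma hnorm_ge0 (R : realType) (V : normedModType R[i]) (x : V) : 0 <= hnorm x.
Proof. by rewrite -lecR hnormE normr_ge0. Qed.

Lemma hnormZ (R : realType) (V : normedModType R[i]) (c : R[i]) (x : V) :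
  hnorm (c *: x) = complex.Re `|c| * hnorm x.
Proof.
have cE : (complex.Re `|c|)%:C%C = `|c| by exact: (@hnormE R R[i]^o c).
by rewrite {1}/hnorm normrZ -[`|x|]hnormE -cE -rmorphM.
Qed.

Definition bounded_operator (R : realType) (H K : hilbertType R) (T : H -> K) :=
  exists C : R, forall x, hnorm (T x) <= C * hnorm x.

Record bop (R : realType) (H K : hilbertType R) := Bop {
  bop_fun :> {linear H -> K} ;
  bop_bounded : bounded_operator bop_fun
}.

Definition opnorm (R : realType) (H K : hilbertType R) (T : bop H K) : R :=
  sup [set hnorm (T x) | x in [set x : H | hnorm x <= 1]].

Lemma bop_scale_bounded (R : realType) (H K : hilbertType R) (c : R[i])
  (T : bop H K) : bounded_operator (c \*: T).
Proof.
have [C TC] := bop_bounded T; exists (complex.Re `|c| * C) => x /=.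
rewrite hnormZ -mulrA ler_wpM2l //; exact: (@hnorm_ge0 R R[i]^o).
Qed.

Definition bop_scale (R : realType) (H K : hilbertType R) (c : R[i])
  (T : bop H K) : bop H K := Bop (bop_scale_bounded c T).

(* [M] belongs to GL(H), with inverse [N]. *)
Definition is_inverse (R : realType) (H : hilbertType R) (M N : bop H H) :=
  cancel M N /\ cancel N M.

Section direct_sum.
Context (R : realType) (I : choiceType) (K : I -> hilbertType R).

Definition square_summable (x : forall i, K i) : Prop :=
  (\esum_(i in [set: I]) (hnorm (x i) ^+ 2)%:E < +oo)%E.

Record dsum := Dsum {
  dsum_val :> forall i, K i ;
  dsum_summable : square_summable dsum_val
}.

Lemma square_summable_dfwith (i : I) (v : K i) :
  square_summable (dfwith (fun j => 0 : K j) i v).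
Proof.
rewrite /square_summable (esumID [set i]); last first.
  by move=> j _; rewrite lee_fin sqr_ge0.
rewrite setTI esum_set1 ?lee_fin ?sqr_ge0// esum1 ?adde0 ?ltry//.
by move=> j [_ /= /eqP ji]; rewrite dfwithout 1?eq_sym// hnorm0 expr0n.
Qed.

Lemma square_summable0 : square_summable (fun i => 0 : K i).
Proof.
by rewrite /square_summable esum1 ?ltry// => i _; rewrite hnorm0 expr0n.
Qed.

HB.instance Definition _ := gen_eqMixin dsum.
HB.instance Definition _ := gen_choiceMixin dsum.
HB.instance Definition _ := isPointed.Build dsum (Dsum square_summable0).

Definition dsum_incl (i : I) (v : K i) : dsum :=
  Dsum (square_summable_dfwith v).

Definition dsum_ball (x : dsum) (e : R) : set dsum :=
  [set y | (\esum_(i in [set: I]) (hnorm (x i - y i) ^+ 2)%:E < (e ^+ 2)%:E)%E].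

Definition dsum_open : set (set dsum) :=
  [set U | forall x, U x -> exists2 e : R, 0 < e & dsum_ball x e `<=` U].

(* [dsum_ball] and [dsum_open] are the balls and open sets of the norm
   topology of the Hilbert direct sum. *)
Definition dsum_borel := g_sigma_algebraType dsum_open.

End direct_sum.

Section continuous_g_frames.
Context d (Omega : measurableType d) (R : realType).
Variable mu : {measure set Omega -> \bar R}.
Variables (H : hilbertType R) (K : Omega -> hilbertType R).

Definition strongly_measurable (F : forall w, K w) :=
  measurable_fun [set: Omega] (fun w => dsum_incl (F w) : dsum_borel K).

Definition sq_integral (L : forall w, bop H (K w)) (f : H) : \bar R :=
  (\int[mu]_w (hnorm (L w f) ^+ 2)%:E)%E.

Definition g_measurable (L : forall w, bop H (K w)) :=
  forall f : H, strongly_measurable (fun w => L w f).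

Definition g_bessel (L : forall w, bop H (K w)) (B : R) :=
  g_measurable L /\
  forall f : H, (sq_integral L f <= (B * hnorm f ^+ 2)%:E)%E.

Definition g_frame_bounds (L : forall w, bop H (K w)) (A B : R) :=
  [/\ 0 < A, A <= B & forall f : H,
    ((A * hnorm f ^+ 2)%:E <= sq_integral L f <= (B * hnorm f ^+ 2)%:E)%E].

Definition g_frame (L : forall w, bop H (K w)) :=
  g_measurable L /\ exists A B : R, g_frame_bounds L A B.

Definition g_frame_lower_bound (L : forall w, bop H (K w)) (A : R) :=
  exists B : R, g_frame_bounds L A B.

Definition family_scale (m : Omega -> R[i]) (L : forall w, bop H (K w)) :
  forall w, bop H (K w) := fun w => bop_scale (m w) (L w).

Definition Linfty_norm (m : Omega -> R[i]) : \bar R :=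
  Lnorm mu +oo%E (fun w => (complex.Re `|m w|)%:E).

Definition in_Linfty (m : Omega -> R[i]) :=
  [/\ measurable_fun [set: Omega] (fun w => complex.Re (m w)),
      measurable_fun [set: Omega] (fun w => complex.Im (m w))
    & (Linfty_norm m < +oo)%E].

Definition complex_integral (h : Omega -> R[i]) : R[i] :=
  Complex (\int[mu]_w complex.Re (h w)) (\int[mu]_w complex.Im (h w)).

(* [M] is the multiplier M_{m,L,T}: this determines [M] uniquely. *)
Definition is_multiplier (m : Omega -> R[i]) (L T : forall w, bop H (K w))
    (M : bop H H) :=
  forall f g : H,
    inner (M f) g = complex_integral (fun w => m w * inner (T w f) (L w g)).

End continuous_g_frames.

(* Main.v *)
Require Import Defs.
From mathcomp Require Import all_boot all_order all_algebra.
From mathcomp Require Import complex.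
From mathcomp Require Import all_classical all_reals all_analysis.
From mathcomp Require Import measurable_realfun ess_sup_inf ring lra.

Set Implicit Arguments.
Unset Strict Implicit.
Unset Printing Implicit Defensive.

Import Order.TTheory GRing.Theory Num.Theory.
Import numFieldNormedType.Exports.

Local Open Scope classical_set_scope.
Local Open Scope ring_scope.

(** The identity [<M f, g> = \int m <Theta f, Lambda g>] can be read as
    [\int <P f, Q g>] with either [(P, Q) = (m Theta, Lambda)] or
    [(P, Q) = (Theta, conj m Lambda)].  In both readings [P] and [Q] are Bessel
    families, and the Cauchy-Schwarz inequality gives
    [(Re <M f, g>) ^ 2 <= I_P f * I_Q g], where [I_L f] is the integral of
    [|L f| ^ 2] (lemma [multiplier_sqr_le]).

    Taking [g = M f] and bounding [I_Q (M f)] by the Bessel constant [BQ] gives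
    [|M f| ^ 2 <= BQ * I_P f], hence
    [|f| ^ 2 = |M^-1 (M f)| ^ 2 <= BQ * |M^-1| ^ 2 * I_P f]
    ([hnorm_sqr_le_left]).  Taking [f = M^-1 g] and bounding [I_P (M^-1 g)]
    gives [|g| ^ 2 <= BP * |M^-1| ^ 2 * I_Q g] ([hnorm_sqr_le_right]).  These two
    estimates in the two readings are the four lower frame bounds: the family
    that absorbs [m] has its Bessel constant multiplied by the square of the
    essential supremum of [m] ([g_bessel_scale]), whence the factor in the
    bounds for [Theta] and [Lambda] themselves.

    Measurability rests on [strongly_measurableP].  The vectors [F w], for
    distinct [w], are put in pairwise orthogonal summands of the direct sum, so
    the nonzero values of [F] are isolated from one another, and [F] is
    strongly measurable exactly when every subset of the set where [F] does not
    vanish is measurable.  All functions integrated below vanish wherever a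
    strongly measurable family does, so they are measurable whatever their
    shape. *)

(** * Hilbert space inequalities *)

(** Optimising the weight [t] in the weighted arithmetic-geometric mean
    inequality recovers the geometric mean; [t = x / a] is the best weight in the
    extremal case [x ^+ 2 = a * b]. *)
Lemma sqr_le_of_amgm (R : realFieldType) (a b x : R) :
  0 <= a -> 0 <= b -> 0 <= x ->
  (forall t, 0 < t -> x *+ 2 <= t * a + t^-1 * b) -> x ^+ 2 <= a * b.
Proof.
move=> a0 b0; rewrite le_eqVlt => /orP[/eqP <- _|x0 h].
  by rewrite expr0n mulr_ge0.
move: a0; rewrite le_eqVlt => /orP[/eqP a0|a0].
  (* A vanishing [a] forces [x * 2 <= t^-1 * b] for all [t], which this [t]
     turns into [x * 2 <= x]. *)
  have tp : 0 < (b + 1) / x by rewrite divr_gt0// ltr_wpDl.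
  have := h _ tp; rewrite -a0 mulr0 add0r mul0r invf_div => h1.
  have b1 : 0 < b + 1 by lra.
  have : x / (b + 1) * b <= x.
    by rewrite mulrAC ler_pdivrMr// mulrDr mulr1 lerDl ltW.
  lra.
have := h (x / a) (divr_gt0 x0 a0).
rewrite divfK ?gt_eqF// invf_div mulr2n lerD2l mulrAC ler_pdivlMr//.
Qed.

Section hilbert.
Context (R : realType) (V W : hilbertType R).

Lemma hnorm_eq0 (x : V) : hnorm x = 0 -> x = 0.
Proof. by move=> x0; apply: normr0_eq0; rewrite -hnormE x0. Qed.

Lemma hnorm_gt0 (x : V) : x != 0 -> 0 < hnorm x.
Proof.
move=> x0; rewrite lt_neqAle hnorm_ge0 andbT eq_sym.
by apply: contra_neq x0; exact: hnorm_eq0.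
Qed.

Lemma inner_self (x : V) : inner x x = (hnorm x ^+ 2)%:C%C.
Proof. by rewrite rmorphXn /= hnormE norm_inner. Qed.

Lemma hnorm_sqZ (c : R[i]) (x : V) :
  hnorm (c *: x) ^+ 2 = complex.Re `|c| ^+ 2 * hnorm x ^+ 2.
Proof. by rewrite hnormZ exprMn. Qed.

Lemma hnorm_sqBZ (t : R) (x y : V) : hnorm (t%:C%C *: x - y) ^+ 2 =
  t ^+ 2 * hnorm x ^+ 2 - 2 * t * complex.Re (inner x y) + hnorm y ^+ 2.
Proof.
have := dnormB (@inner R V) (t%:C%C *: x) y.
rewrite linearZl_LR/= [X in _ = _ - X](addcJ (t%:C%C * inner x y)) !inner_self.
rewrite hnorm_sqZ => /(congr1 (@complex.Re R)).
have -> : complex.Re `|t%:C%C : R[i]| = `|t|.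
  by rewrite normc_def /= expr0n addr0 sqrtr_sqr.
rewrite real_normK ?num_real// raddfB/=; case: (inner x y) => a b /= ->; ring.
Qed.

(** Expanding [0 <= |t x - y| ^ 2] and [0 <= |- t x - y| ^ 2] bounds both signs
    of the real part. *)
Lemma Re_inner_amgm (t : R) (x y : V) : 0 < t ->
  `|complex.Re (inner x y)| *+ 2 <= t * hnorm x ^+ 2 + t^-1 * hnorm y ^+ 2.
Proof.
move=> t0; have H s : s ^+ 2 = t ^+ 2 ->
    s / t * complex.Re (inner x y) *+ 2 <=
    t * hnorm x ^+ 2 + t^-1 * hnorm y ^+ 2.
  move=> st; have := sqr_ge0 (hnorm (s%:C%C *: x - y)); rewrite hnorm_sqBZ st.
  set h := (X in 0 <= X -> _) => h0.
  rewrite -subr_ge0 [leRHS](_ : _ = t^-1 * h); last first.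
    by rewrite /h; field; rewrite gt_eqF.
  by rewrite mulr_ge0// invr_ge0 ltW.
have := H _ (erefl (t ^+ 2)); have := H _ (sqrrN t).
rewrite mulNr divff ?gt_eqF// mulN1r mul1r => h1 h2.
by case: (ger0P (complex.Re (inner x y))).
Qed.

Lemma hnorm_le_opnorm (T : bop V W) (x : V) : hnorm (T x) <= opnorm T * hnorm x.
Proof.
have [->|x0] := eqVneq x 0; first by rewrite linear0 !hnorm0 mulr0.
have n0 := hnorm_gt0 x0.
rewrite -ler_pdivrMr//.
have cE : complex.Re `|((hnorm x)^-1)%:C%C : R[i]| = (hnorm x)^-1.
  by rewrite ger0_norm// lecR invr_ge0 ltW.
have -> : hnorm (T x) / hnorm x = hnorm (T (((hnorm x)^-1)%:C%C *: x)).
  by rewrite linearZ/= hnormZ cE mulrC.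
apply: ub_le_sup.
  (* The constant [C] may be negative, which only happens on the zero space. *)
  have [C TC] := bop_bounded T; exists (Num.max C 0) => _ [y /= y1 <-].
  apply: le_trans (TC y) _; apply: le_trans (_ : Num.max C 0 * hnorm y <= _).
    by rewrite ler_wpM2r ?hnorm_ge0// le_max lexx.
  by rewrite ler_piMr// le_max lexx orbT.
by eexists; last by []; rewrite /= hnormZ cE mulVf ?gt_eqF.
Qed.

Lemma hnorm_sqr_le_opnorm (T : bop V W) (x : V) :
  hnorm (T x) ^+ 2 <= opnorm T ^+ 2 * hnorm x ^+ 2.
Proof.
have h := hnorm_le_opnorm T x; rewrite -exprMn lerXn2r// nnegrE ?hnorm_ge0//.
exact: le_trans (hnorm_ge0 _) h.
Qed.

End hilbert.

(** * Strong measurability *)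

Section strong_measurability.
Context d (Omega : measurableType d) (R : realType) (K : Omega -> hilbertType R).
Implicit Types F : forall w, K w.

(** A coordinate stays nonzero as long as it moves by less than its own norm,
    and no coordinate moves more than the whole vector.  These open sets
    separate the nonzero values of a family, since [dsum_incl (F w)] has no
    nonzero coordinate other than [w]. *)
Lemma dsum_open_neq0 (S : set Omega) :
  @dsum_open R Omega K [set x | exists2 w, S w & dsum_val x w != 0].
Proof.
move=> x [w Sw xw]; exists (hnorm (x w)); first exact: hnorm_gt0.
move=> y yx; exists w => //; apply/eqP => yw0.
move: yx; rewrite /dsum_ball/= (esumID [set w]); last first.
  by move=> i _; rewrite lee_fin sqr_ge0.
rewrite setTI esum_set1 ?lee_fin ?sqr_ge0// yw0 subr0.
rewrite -[ltRHS]adde0 ltNge leeD2l//.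
by apply: esum_ge0 => i _; rewrite lee_fin sqr_ge0.
Qed.

Lemma dsum_inj (x y : dsum K) : dsum_val x = dsum_val y -> x = y.
Proof.
case: x y => [f Pf] [g Pg] /= fg; subst g; congr Dsum; exact: Prop_irrelevance.
Qed.

(** All the zero values of a family, although taken in different spaces, are the
    single point 0 of the direct sum. *)
Lemma dsum_incl_eq0 F w w' : F w = 0 -> F w' = 0 ->
  dsum_incl (F w) = dsum_incl (F w').
Proof.
move=> Fw Fw'; apply: dsum_inj.
suff E v : F v = 0 -> dsum_val (dsum_incl (F v)) = fun=> 0 by rewrite !E.
move=> Fv; apply/functional_extensionality_dep => i /=.
by have [<-|vi] := eqVneq v i; [rewrite dfwithin|rewrite dfwithout].
Qed.

(** The sets of [dsum_open_neq0] pull back to arbitrary subsets of the locus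
    where [F] does not vanish.  Conversely, the preimage of any set avoiding 0
    lies in that locus, and so does the complement of the preimage of any set
    containing 0. *)
Lemma strongly_measurableP F : strongly_measurable F <->
  forall S : set Omega, (forall w, S w -> F w != 0) -> measurable S.
Proof.
split=> [mF S SF|mS].
  have mU : @measurable _ (dsum_borel K)
      [set x | exists2 w, S w & dsum_val x w != 0].
    by apply: sub_sigma_algebra; exact: dsum_open_neq0.
  have := mF measurableT _ mU.
  rewrite setTI; congr measurable; apply/seteqP; split=> w /=.
    move=> [w' Sw']; have [ww'|ww'] := eqVneq w' w.
      by move=> _; rewrite -ww'.
    by rewrite dfwithout 1?eq_sym// eqxx.
  by move=> Sw; exists w => //; rewrite dfwithin SF.
apply: (@measurability _ _ _ (dsum_borel K) _ _ (@dsum_open R Omega K)) => //.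
move=> _ [U oU <-].
rewrite setTI.
have [[w0 [Fw0 Uw0]]|nU] := pselect (exists w, F w = 0 /\ U (dsum_incl (F w))).
  rewrite -[X in measurable X]setCK; apply: measurableC; apply: mS => w /= Uw.
  by apply: contra_notN Uw => /eqP Fw; rewrite (dsum_incl_eq0 Fw Fw0).
by apply: mS => w /= Uw; apply/eqP => Fw; apply: nU; exists w.
Qed.

Lemma measurable_off_zero F (g : Omega -> R) : strongly_measurable F ->
  (forall w, F w = 0 -> g w = 0) -> measurable_fun [set: Omega] g.
Proof.
move=> /strongly_measurableP mF gF _ B mB; rewrite setTI.
have [B0|nB0] := pselect (B 0).
  rewrite -[X in measurable X]setCK; apply: measurableC; apply: mF => w /= Bw.
  by apply: contra_notN Bw => /eqP Fw; rewrite gF.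
by apply: mF => w /= Bw; apply/eqP => Fw; apply: nB0; rewrite -(gF _ Fw).
Qed.

Lemma strongly_measurableZ (m : Omega -> R[i]) F : strongly_measurable F ->
  strongly_measurable (fun w => m w *: F w).
Proof.
move=> /strongly_measurableP mF; apply/strongly_measurableP => S SF.
by apply: mF => w /SF; apply: contra_neq => ->; rewrite scaler0.
Qed.

Lemma measurable_hnorm_sq F : strongly_measurable F ->
  measurable_fun [set: Omega] (fun w => hnorm (F w) ^+ 2).
Proof.
by move=> mF; apply: (measurable_off_zero mF) => w ->; rewrite hnorm0 expr0n.
Qed.

End strong_measurability.

(** * Integral estimates *)

Section integral_estimates.
Context d (Omega : measurableType d) (R : realType).
Variable mu : {measure set Omega -> \bar R}.
Variable (K : Omega -> hilbertType R).
Implicit Types F G : forall w, K w.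

(** Cauchy-Schwarz in the space of square integrable families: integrate
    [Re_inner_amgm], then optimise the weight. *)
Lemma Rintegral_inner_sqr_le F G (a b : R) :
  strongly_measurable F -> strongly_measurable G ->
  (\int[mu]_w (hnorm (F w) ^+ 2)%:E <= a%:E)%E ->
  (\int[mu]_w (hnorm (G w) ^+ 2)%:E <= b%:E)%E ->
  (\int[mu]_w complex.Re (inner (F w) (G w))) ^+ 2 <= a * b.
Proof.
move=> mF mG Fa Gb; set h := fun w => complex.Re (inner (F w) (G w)).
have sq0 (P : forall w, K w) : (0 <= \int[mu]_w (hnorm (P w) ^+ 2)%:E)%E.
  by apply: integral_ge0 => w _; rewrite lee_fin sqr_ge0.
have a0 : 0 <= a by rewrite -lee_fin (le_trans (sq0 F)).
have b0 : 0 <= b by rewrite -lee_fin (le_trans (sq0 G)).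
have mh : measurable_fun [set: Omega] h.
  by apply: (measurable_off_zero mF) => w F0; rewrite /h F0 linear0l.
have msq (P : forall w, K w) : strongly_measurable P ->
    measurable_fun [set: Omega] (EFin \o (fun w => hnorm (P w) ^+ 2)).
  by move=> mP; apply/measurable_EFinP; exact: measurable_hnorm_sq.
have amgm t : 0 < t ->
    (2%:E * \int[mu]_w `|(h w)%:E| <= (t * a + t^-1 * b)%:E)%E.
  move=> t0; have ti0 : 0 <= t^-1 by rewrite invr_ge0 ltW.
  have mhe : measurable_fun [set: Omega] (abse \o (EFin \o h)).
    by apply: measurableT_comp => //; exact/measurable_EFinP.
  rewrite -ge0_integralZl//.
  apply: (@le_trans _ _ (\int[mu]_w
    (t%:E * (hnorm (F w) ^+ 2)%:E + t^-1%:E * (hnorm (G w) ^+ 2)%:E))%E).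
    apply: ge0_le_integral => //.
    - exact: measurable_funeM.
    - by apply: emeasurable_funD; apply: measurable_funeM; exact: msq.
    - move=> w _; rewrite -!EFinM -EFinD lee_fin mulr_natl; exact: Re_inner_amgm.
  have intZ c (P : forall w, K w) : 0 <= c -> strongly_measurable P ->
      (\int[mu]_w (c%:E * (hnorm (P w) ^+ 2)%:E) =
       c%:E * \int[mu]_w (hnorm (P w) ^+ 2)%:E)%E.
    move=> c0 mP; apply: ge0_integralZl => //; first exact: msq.
    by move=> w _; rewrite lee_fin sqr_ge0.
  have mZ c (P : forall w, K w) : strongly_measurable P ->
      measurable_fun [set: Omega] (fun w => c%:E * (hnorm (P w) ^+ 2)%:E)%E.
    by move=> mP; apply: measurable_funeM; exact: msq.
  have Z0 c (P : forall w, K w) w : 0 <= c ->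
      (0 <= c%:E * (hnorm (P w) ^+ 2)%:E)%E.
    by move=> c0; rewrite mule_ge0// lee_fin sqr_ge0.
  rewrite (ge0_integralD _ _ (fun w _ => Z0 _ _ w (ltW t0)) (mZ _ _ mF)
    (fun w _ => Z0 _ _ w ti0) (mZ _ _ mG))//.
  rewrite (intZ _ _ (ltW t0) mF) (intZ _ _ ti0 mG).
  by rewrite EFinD !EFinM leeD// lee_pmul2l// lte_fin invr_gt0.
have hint : (\int[mu]_w `|(h w)%:E| < +oo)%E.
  have := amgm 1 ltr01; rewrite !ltey; apply: contraPneq => ->.
  by rewrite gt0_muley ?lte_fin// leye_eq.
have ih : mu.-integrable [set: Omega] (EFin \o h).
  by apply/integrableP; split => //; exact/measurable_EFinP.
have habs : `|\int[mu]_w h w| <= fine (\int[mu]_w `|(h w)%:E|)%E.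
  exact: le_normr_Rintegral.
rewrite -real_normK ?num_real//.
apply: sqr_le_of_amgm => // t t0; rewrite -mulr_natl.
apply: le_trans (_ : 2 * fine (\int[mu]_w `|(h w)%:E|)%E <= _).
  by rewrite ler_wpM2l.
rewrite -lee_fin EFinM fineK ?amgm// ge0_fin_numE//.
by apply: integral_ge0.
Qed.

(** Since [m] does not vanish almost everywhere, the whole space has positive
    measure, so that the supremum norm is an essential supremum. *)
Lemma Linfty_normP (m : Omega -> R[i]) : in_Linfty mu m ->
  ~ (\forall w \ae mu, m w = 0) ->
  0 <= fine (Linfty_norm mu m) /\
  \forall w \ae mu, complex.Re `|m w| <= fine (Linfty_norm mu m).
Proof.
move=> [_ _ mfin] m0; have mu0 : (0 < mu [set: Omega])%E.
  rewrite lt_neqAle measure_ge0 andbT; apply/eqP => mu0; apply: m0.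
  by exists setT; split.
have E : Linfty_norm mu m = ess_sup mu (fun w => (complex.Re `|m w|)%:E).
  rewrite /Linfty_norm unlock /= mu0; congr ess_sup; apply/funext => w /=.
  by rewrite ger0_norm //; exact: (@hnorm_ge0 R R[i]^o).
have E0 : (0 <= Linfty_norm mu m)%E.
  rewrite E; apply: ess_sup_gee => //; apply: nearW => w; rewrite lee_fin.
  exact: (@hnorm_ge0 R R[i]^o).
split; first exact: fine_ge0.
have := ess_sup_ge mu (fun w => (complex.Re `|m w|)%:E); apply: filterS => w.
by rewrite -E -lee_fin fineK// ge0_fin_numE.
Qed.

Lemma integral_scale_le (m : Omega -> R[i]) F (c : R) : 0 <= c ->
  strongly_measurable F -> (\forall w \ae mu, complex.Re `|m w| <= c) ->
  (\int[mu]_w (hnorm (m w *: F w) ^+ 2)%:E <=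
   (c ^+ 2)%:E * \int[mu]_w (hnorm (F w) ^+ 2)%:E)%E.
Proof.
move=> c0 mF mc.
have m1 : measurable_fun [set: Omega] (EFin \o (fun w => hnorm (F w) ^+ 2)).
  by apply/measurable_EFinP; exact: measurable_hnorm_sq.
rewrite -ge0_integralZl ?lee_fin ?sqr_ge0//; last first.
  by move=> w _; rewrite lee_fin sqr_ge0.
apply: ae_ge0_le_integral => //.
- by move=> w _; rewrite lee_fin sqr_ge0.
- apply/measurable_EFinP; apply: measurable_hnorm_sq.
  exact: strongly_measurableZ.
- by move=> w _; rewrite mule_ge0// lee_fin sqr_ge0.
- exact: measurable_funeM.
- apply: filterS mc => w mc _; rewrite -EFinM lee_fin hnorm_sqZ.
  by rewrite ler_wpM2r ?sqr_ge0// ler_sqr// nnegrE; exact: (@hnorm_ge0 R R[i]^o).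
Qed.

End integral_estimates.

(** * Continuous g-frames *)

Section g_frames.
Context d (Omega : measurableType d) (R : realType).
Variable mu : {measure set Omega -> \bar R}.
Variables (H : hilbertType R) (K : Omega -> hilbertType R).
Implicit Types P Q L T : forall w, bop H (K w).

Lemma sq_integral_ge0 L f : (0 <= sq_integral mu L f)%E.
Proof. by apply: integral_ge0 => w _; rewrite lee_fin sqr_ge0. Qed.

Lemma sq_integral0 L : sq_integral mu L 0 = 0%E.
Proof.
by apply: integral0_eq => w _; rewrite linear0 hnorm0 expr0n.
Qed.

Lemma g_bessel_fineK L B f : g_bessel mu L B ->
  ((fine (sq_integral mu L f))%:E = sq_integral mu L f)%E.
Proof.
move=> [_ LB]; rewrite fineK// ge0_fin_numE ?sq_integral_ge0//.
exact: le_lt_trans (LB f) (ltry _).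
Qed.

Lemma g_bessel_fine_le L B f : g_bessel mu L B ->
  fine (sq_integral mu L f) <= B * hnorm f ^+ 2.
Proof. by move=> LB; rewrite -lee_fin (g_bessel_fineK _ LB); case: LB. Qed.

Lemma g_bessel_scale (m : Omega -> R[i]) L B : in_Linfty mu m ->
  ~ (\forall w \ae mu, m w = 0) -> g_bessel mu L B ->
  g_bessel mu (family_scale m L) (B * fine (Linfty_norm mu m) ^+ 2).
Proof.
move=> mL m0 [mLf LB]; have [c0 mc] := Linfty_normP mL m0.
split=> f; first exact: strongly_measurableZ.
apply: le_trans (integral_scale_le c0 (mLf f) mc) _.
rewrite (_ : _ * hnorm f ^+ 2 =
    fine (Linfty_norm mu m) ^+ 2 * (B * hnorm f ^+ 2)); last by ring.
rewrite [leRHS]EFinM; apply: lee_wpmul2l; last exact: LB.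
by rewrite lee_fin sqr_ge0.
Qed.

(** Any nonzero vector forces [c] to be positive; on the zero space all positive
    constants [A <= B] are frame bounds.  The upper bound is enlarged to
    [Num.max _ B] because [B] may be smaller than the lower bound when the space
    is zero. *)
Lemma g_frame_of_lower L (B c : R) : g_bessel mu L B ->
  (forall f, hnorm f ^+ 2 <= c * fine (sq_integral mu L f)) ->
  g_frame mu L /\ ((exists f : H, f != 0) -> g_frame_lower_bound mu L c^-1).
Proof.
move=> LB Lc.
have bnd A : 0 < A ->
    (forall f, A * hnorm f ^+ 2 <= fine (sq_integral mu L f)) ->
    g_frame_lower_bound mu L A.
  move=> A0 LA; exists (Num.max A B); split=> // [|f]; first by rewrite le_max lexx.
  rewrite -(g_bessel_fineK f LB) !lee_fin LA/=.
  apply: le_trans (g_bessel_fine_le f LB) _.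
  by rewrite ler_wpM2r ?sqr_ge0// le_max lexx orbT.
have lower : (exists f : H, f != 0) -> g_frame_lower_bound mu L c^-1.
  move=> [f0 f0n0]; have c0 : 0 < c.
    have I0 : 0 <= fine (sq_integral mu L f0) by exact/fine_ge0/sq_integral_ge0.
    have := lt_le_trans (exprn_gt0 2 (hnorm_gt0 f0n0)) (Lc f0).
    by rewrite !ltNge; apply: contra => c0; exact: mulr_le0_ge0.
  apply: bnd => [|f]; first by rewrite invr_gt0.
  by rewrite mulrC ler_pdivrMr// mulrC.
split=> //; split; first by case: LB.
have [ex|nex] := pselect (exists f : H, f != 0).
  by have [B' ?] := lower ex; exists c^-1, B'.
have H0 (f : H) : f = 0 by apply: contrapT => /eqP f0; apply: nex; exists f.
have [B' ?] : g_frame_lower_bound mu L 1; last by exists 1, B'.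
by apply: bnd => // f; rewrite (H0 f) hnorm0 expr0n/= mulr0 fine_ge0// sq_integral_ge0.
Qed.

Section lower_bounds.
Variables (P Q : forall w, bop H (K w)) (BP BQ : R) (M N : bop H H).
Hypotheses (PB : g_bessel mu P BP) (QB : g_bessel mu Q BQ) (MN : is_inverse M N).
Hypothesis MPQ : forall f g : H, complex.Re (inner (M f) g) =
  \int[mu]_w complex.Re (inner (P w f) (Q w g)).

Lemma multiplier_sqr_le f g : complex.Re (inner (M f) g) ^+ 2 <=
  fine (sq_integral mu P f) * fine (sq_integral mu Q g).
Proof.
rewrite MPQ; apply: Rintegral_inner_sqr_le.
- by case: PB => + _; exact.
- by case: QB => + _; exact.
- by rewrite (g_bessel_fineK _ PB).
- by rewrite (g_bessel_fineK _ QB).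
Qed.

(** [multiplier_sqr_le] at [g = M f], where the left-hand side is [|M f| ^ 4] and
    one factor [|M f| ^ 2] cancels. *)
Lemma hnorm_sqr_le_left f :
  hnorm f ^+ 2 <= BQ * opnorm N ^+ 2 * fine (sq_integral mu P f).
Proof.
case: MN => MK _; have I0 : 0 <= fine (sq_integral mu P f).
  exact/fine_ge0/sq_integral_ge0.
have fM := hnorm_sqr_le_opnorm N (M f); rewrite MK in fM.
have [Mf0|/hnorm_gt0 /(exprn_gt0 2) Mf0] := eqVneq (M f) 0.
  have -> : f = 0 by rewrite -(MK f) Mf0 linear0.
  by rewrite sq_integral0 hnorm0 expr0n mulr0.
have := multiplier_sqr_le f (M f); rewrite inner_self/= => h.
have {h} : hnorm (M f) ^+ 2 <= fine (sq_integral mu P f) * BQ.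
  rewrite -(ler_pM2r Mf0) -expr2; apply: le_trans h _.
  by rewrite -mulrA ler_wpM2l// (g_bessel_fine_le _ QB).
rewrite mulrC => h; rewrite mulrAC mulrC; apply: le_trans fM _.
by rewrite ler_wpM2l ?sqr_ge0.
Qed.

(** [multiplier_sqr_le] at [f = N g], where the left-hand side is [|g| ^ 4] and
    one factor [|g| ^ 2] cancels. *)
Lemma hnorm_sqr_le_right g :
  hnorm g ^+ 2 <= BP * opnorm N ^+ 2 * fine (sq_integral mu Q g).
Proof.
case: MN => _ NK; have J0 : 0 <= fine (sq_integral mu Q g).
  exact/fine_ge0/sq_integral_ge0.
have [->|g0] := eqVneq g 0.
  by rewrite sq_integral0 hnorm0 expr0n mulr0.
have n0 := exprn_gt0 2 (hnorm_gt0 g0).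
have Ng0 : 0 < hnorm (N g) ^+ 2.
  by apply/exprn_gt0/hnorm_gt0; apply: contra_neq g0 => h; rewrite -(NK g) h linear0.
(* A Bessel constant is nonnegative as soon as the space is nonzero. *)
have BP0 : 0 <= BP.
  rewrite -(pmulr_lge0 _ Ng0); apply: le_trans (g_bessel_fine_le _ PB).
  exact/fine_ge0/sq_integral_ge0.
have := multiplier_sqr_le (N g) g; rewrite NK inner_self/= => h.
rewrite -(ler_pM2r n0) -expr2; apply: le_trans h _.
rewrite mulrAC ler_wpM2r//; apply: le_trans (g_bessel_fine_le _ PB) _.
by rewrite -mulrA ler_wpM2l// hnorm_sqr_le_opnorm.
Qed.

End lower_bounds.

End g_frames.

Lemma in_Linfty_conj d (Omega : measurableType d) (R : realType)
    (mu : {measure set Omega -> \bar R}) (m : Omega -> R[i]) :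
  in_Linfty mu m ->
  in_Linfty mu (fun w => (m w)^*%C) /\
  Linfty_norm mu (fun w => (m w)^*%C) = Linfty_norm mu m.
Proof.
have E : Linfty_norm mu (fun w => (m w)^*%C) = Linfty_norm mu m.
  by apply: eq_Lnorm => w; rewrite (norm_conjC (m w)).
move=> [mRe mIm mfin]; split=> //; split; last by rewrite E.
- by apply: eq_measurable_fun mRe => w _; case: (m w).
- apply: eq_measurable_fun (measurableT_comp (@oppr_measurable R _) mIm) => w _ /=.
  by case: (m w).
Qed.

Theorem proposition2p2 (d : measure_display) (Omega : measurableType d)
    (R : realType) (mu : {measure set Omega -> \bar R})
    (H : hilbertType R) (K : Omega -> hilbertType R)
    (Lambda Theta : forall w : Omega, bop H (K w)) (BL BT : R)
    (m : Omega -> R[i]) (M Minv : bop H H) :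
  g_bessel mu Lambda BL ->
  g_bessel mu Theta BT ->
  in_Linfty mu m ->
  ~ (\forall w \ae mu, m w = 0) ->
  is_multiplier mu m Lambda Theta M ->
  is_inverse M Minv ->
  (* (i) *)
  [/\ g_frame mu (family_scale m Theta),
      g_frame mu (family_scale (fun w => (m w)^*%C) Lambda)
    & (exists f : H, f != 0) ->
      g_frame_lower_bound mu (family_scale m Theta)
        (BL * opnorm Minv ^+ 2)^-1 /\
      g_frame_lower_bound mu (family_scale (fun w => (m w)^*%C) Lambda)
        (BT * opnorm Minv ^+ 2)^-1] /\
  (* (ii) *)
  [/\ g_frame mu Theta,
      g_frame mu Lambda
    & (exists f : H, f != 0) ->
      g_frame_lower_bound mu Theta
        (BL * fine (Linfty_norm mu m) ^+ 2 * opnorm Minv ^+ 2)^-1 /\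
      g_frame_lower_bound mu Lambda
        (BT * fine (Linfty_norm mu m) ^+ 2 * opnorm Minv ^+ 2)^-1].
Proof.
move=> LB TB mL m0 MLT MN.
have [cL cE] := in_Linfty_conj mL.
have c0 : ~ (\forall w \ae mu, (m w)^*%C = 0).
  move=> c0; apply: m0; apply: filterS c0 => w /eqP.
  by rewrite conjc_eq0 => /eqP.
have mTB := g_bessel_scale mL m0 TB.
have cLB := g_bessel_scale cL c0 LB; rewrite cE in cLB.
(* The two readings of the multiplier. *)
have repr1 f g : complex.Re (inner (M f) g) =
    \int[mu]_w complex.Re (inner (family_scale m Theta w f) (Lambda w g)).
  rewrite MLT/=; apply: eq_Rintegral => w _.
  by rewrite linearZl_LR.
have repr2 f g : complex.Re (inner (M f) g) =
    \int[mu]_w complex.Re (inner (Theta w f)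
      (family_scale (fun w => (m w)^*%C) Lambda w g)).
  rewrite MLT/=; apply: eq_Rintegral => w _.
  rewrite linearZr_LR/=; congr (complex.Re (_ * _)).
  exact/esym/(conjcK (m w)).
have [F1 A1] := g_frame_of_lower mTB (hnorm_sqr_le_left mTB LB MN repr1).
have [F2 A2] := g_frame_of_lower cLB (hnorm_sqr_le_right TB cLB MN repr2).
have [F3 A3] := g_frame_of_lower TB (hnorm_sqr_le_left TB cLB MN repr2).
have [F4 A4] := g_frame_of_lower LB (hnorm_sqr_le_right mTB LB MN repr1).
by split; split=> // H0; split; [exact: A1|exact: A2|exact: A3|exact: A4].
Qed.
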